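(* Let $(X,d)$ be a metric vector space, let $C$ be a nonempty compact and convex subset of $X$, and let $f\colon C\to C$ be a single-valued mapping. Suppose that $f$ satisfies the following conditions: (a) $f\colon C\to C$ is onto; (b) for any finite subset $\{x_1,x_2,\ldots,x_n\}\subseteq C$ and for any convex combination $u=\sum_{i=1}^n\alpha_i x_i$, in which $\alpha_1,\ldots,\alpha_n$ are positive with $\sum_{i=1}^n\alpha_i=1$, we have $$d(f(u),u)\le \max\{d(f(x_j),u) : j=1,2,\ldots,n\};$$ (c) the set $\{x\in C : d(f(x),x)\le\beta\}$ is closed, for any $\beta>0$. Then $\mathcal{F}(f)$ is a nonempty closed subset of $C$.
   Context: A metric vector space $(X,d)$ is a (real) vector space $X$ equipped with a metric $d$ such that $X$ with the topology induced by $d$ is a topological vector space (addition and scalar multiplication are continuous). For a self-mapping $f$ on a set $C$, $\mathcal{F}(f)=\{x\in C : f(x)=x\}=\{x\in C : d(f(x),x)=0\}$ denotes the set of fixed points of $f$. No continuity of $f$ is assumed. *)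

(* Defs.v *)
From HB Require Import structures.
From mathcomp Require Import all_boot all_order all_algebra.
From mathcomp Require Import all_classical all_reals all_analysis.

Set Implicit Arguments.
Unset Strict Implicit.
Unset Printing Implicit Defensive.

Import Order.TTheory GRing.Theory Num.Theory.

Local Open Scope classical_set_scope.
Local Open Scope ring_scope.

(* [metric_inducing d]: [d] is a metric and its topology is the topology of [X].
   A metric vector space is an [X : topologicalLmodType R] together with a [d]
   satisfying [metric_inducing d]; neither translation invariance of [d] nor
   local convexity of [X] is assumed.  The library's [metricType] cannot be used
   instead: Hierarchy Builder rejects the join of [Metric] with
   [TopologicalLmodule], because [PseudoMetricNormedZmod] is already declared
   without the intermediate join this would require. *)
Record metric_inducing (R : realType) (X : topologicalType)
    (d : X -> X -> R) : Prop := MetricInducing {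
  distxx : forall x, d x x = 0 ;
  dist_eq0 : forall x y, d x y = 0 -> x = y ;
  dist_sym : forall x y, d x y = d y x ;
  dist_triangle : forall y x z, d x z <= d x y + d y z ;
  nbhs_dist : forall x,
    nbhs x = nbhs_ball_ (fun y (e : R) => [set z | d y z < e]) x
}.

Definition fixed_points (T : Type) (C : set T) (f : T -> T) : set T :=
  [set x | C x /\ f x = x].

(* Main.v *)
Require Import Defs.
From HB Require Import structures.
From mathcomp Require Import all_boot all_order all_algebra.
From mathcomp Require Import all_classical all_reals all_analysis.
From mathcomp Require Import zify ring lra.

(** Call a point [u] of [C] a [b]-fixed point when [d (f u) u <= b].  The sets
    of [b]-fixed points are closed by (c) and shrink with [b], and the fixed
    points of [f] are their intersection.  So this intersection is closed, and,
    [C] being compact, it is nonempty as soon as [b]-fixed points exist for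
    every [b > 0].

    Fix [b > 0].  As [f] is onto, the balls of radius [b] around the points
    [f x], with [x] in [C], cover [C], so finitely many of them do, say those
    around [f x_0], ..., [f x_n].  Let [u t] be the sum of the [t_i x_i], for
    [t] in the standard simplex.  The closed sets [A_i] of the [t] such that
    [d (f x_i) (u t) <= b] cover the simplex.  If some [t] is in [A_i] for each
    [i] with [t_i > 0], then (b), applied to the [x_i] with [t_i > 0], says that
    [u t] is a [b]-fixed point.

    That such a [t] exists for every closed cover of the simplex is the
    topological core ([simplex_cover_closed]); it is a form of the
    Knaster-Kuratowski-Mazurkiewicz theorem, with the same strength as
    Brouwer's.  It is obtained from a finite statement on the grid of points
    with denominator [N] ([grid_label]): if each grid point has a label, then
    there is a set of grid points of diameter [O(1/N)] such that each index [i]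
    either labels a point of the set or has a coordinate [O(1/N)] on the set.

    The finite statement is proved without any triangulation, by Scarf's method
    ([scarf]).  It needs only a linear order per index on a finite set;
    the role of the simplices of a triangulation is played by the dominant sets,
    those that no point exceeds in all orders at once.  A dominant set with one
    element less than a full one lies in exactly two full ones
    ([card_dominant_rooms]), and parity does the rest, as in Sperner's lemma. *)

Set Implicit Arguments.
Unset Strict Implicit.
Unset Printing Implicit Defensive.

Import Order.TTheory GRing.Theory Num.Theory.
Import numFieldNormedType.Exports.

(** * Counting redundant elements *)

Section redundancy.
Variables (aT rT : finType) (f : aT -> rT).
Implicit Type A : {set aT}.

Lemma imset_setD1_eq A (x y : aT) :
  y \in A -> x != y -> f x = f y -> f @: (A :\ x) = f @: A.
Proof.
move=> Ay xy fxy; apply/eqP; rewrite finset.eqEsubset imsetS ?subsetDl//=.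
apply/fintype.subsetP => _ /imsetP[z Az ->].
have [->|zx] := eqVneq z x.
  by rewrite fxy imset_f// !inE eq_sym xy.
by rewrite imset_f// !inE zx.
Qed.

(** A map that identifies just one pair of elements of [A]: the elements that
    can be removed without shrinking the image are the two of that pair.  This
    one count gives the two facets of Sperner-type arguments: the two neighbours
    of a door, and the two doors of a room. *)
Lemma card_redundant A : #|A| = #|f @: A|.+1 ->
  #|[set x in A | f @: (A :\ x) == f @: A]| = 2.
Proof.
move=> cA.
have /dinjectivePn[x Ax [y /andP[/= yx Ay] fxy]] : ~~ dinjectiveb f (mem A).
  apply/negP => /dinjectiveP fA; move: cA; rewrite (card_in_imset fA).
  by move/eqP; rewrite eqn_leq ltnn andbF.
rewrite -[RHS](_ : #|[set x; y]| = 2); last by rewrite cards2 eq_sym yx.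
apply: eq_card => z; rewrite !inE; apply/andP/orP => [[Az /eqP fz]|].
  have [zx|zx] := eqVneq z x; first by left.
  have [zy|zy] := eqVneq z y; first by right.
  have Dzy : y \in A :\ z by rewrite !inE eq_sym zy.
  have Dzx : x \in A :\ z by rewrite !inE eq_sym zx.
  have xy : x != y by rewrite eq_sym.
  have := leq_imset_card f (mem (A :\ z :\ x)).
  rewrite (imset_setD1_eq Dzy xy fxy) fz.
  have := cardsD1 x (A :\ z); have := cardsD1 z A.
  rewrite Dzx Az; move: cA; set p := #|f @: A|; set q := #|_ :\ x|; lia.
move=> [] /eqP ->.
  by split=> //; rewrite (@imset_setD1_eq _ x y)// eq_sym.
by split=> //; rewrite (@imset_setD1_eq _ y x).
Qed.

End redundancy.

Lemma odd_sum (J : finType) (P : pred J) (F : J -> nat) (j0 : J) :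
  P j0 -> odd (F j0) -> (forall j, P j -> j != j0 -> ~~ odd (F j)) ->
  odd (\sum_(j | P j) F j).
Proof.
move=> Pj0 Fj0 Fj; rewrite (bigD1 j0)//= oddD Fj0/=.
by apply: (big_ind (fun n => ~~ odd n)) => [//|m n mE nE|j /andP[]];
  [rewrite oddD; case: odd mE nE | exact: Fj].
Qed.

(** * Dominant sets for a family of linear orders *)

Section dominant.
Variables (V I : finType) (r : I -> V -> nat).
Hypothesis r_inj : forall k, injective (r k).
Implicit Types A B D : {set V}.

(** The injective ranks [r k] encode linear orders on [V]; no point of [V] is
    strictly above the minimum of a dominant set in all the orders at once. *)
Definition dominant A :=
  [forall y, exists k, [forall x in A, r k y <= r k x]].

Lemma dominantP A :
  reflect (forall y, exists k, forall x, x \in A -> r k y <= r k x)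
          (dominant A).
Proof.
apply: (iffP forallP) => [dA y|dA y].
  by have /existsP[k /forall_inP] := dA y; exists k.
by apply/existsP; have [k kA] := dA y; exists k; apply/forall_inP.
Qed.

Lemma dominantS A B : A \subset B -> dominant B -> dominant A.
Proof.
move=> /fintype.subsetP AB /dominantP dB; apply/dominantP => y.
by have [k kB] := dB y; exists k => x /AB/kB.
Qed.

Section door.
Variables (D : {set V}) (v : V).
Hypotheses (Dv : v \in D) (domD : dominant D) (cardD : #|D|.+1 = #|I|).

Let m k := [arg min_(x < v in D) r k x].

Let mD k : m k \in D. Proof. by rewrite /m; case: arg_minnP. Qed.

Let m_min k x : x \in D -> r k (m k) <= r k x.
Proof. by rewrite /m; case: arg_minnP => // y _; apply. Qed.

Let m_eq k x : x \in D -> (forall y, y \in D -> r k x <= r k y) -> m k = x.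
Proof.
move=> Dx xmin; apply/(@r_inj k)/eqP.
by rewrite eqn_leq m_min// xmin.
Qed.

(* Testing dominance on [x] itself shows that [x] is some minimum of [D]. *)
Let m_onto : m @: [set: I] = D.
Proof.
apply/setP => x; apply/imsetP/idP => [[k _ ->]//|Dx].
by have /dominantP/(_ x)[k /(m_eq Dx)<-] := domD; exists k.
Qed.

(* The orders that can be dropped while [D] keeps all its elements as minima. *)
Let redundant := [set k | m @: ([set: I] :\ k) == D].

Let card_redundant_min : #|redundant| = 2.
Proof.
have := @card_redundant _ _ m [set: I]; rewrite m_onto cardsT -cardD => /(_ erefl) <-.
by apply: eq_card => k; rewrite !inE.
Qed.

(* [y] exceeds the minimum of [D] in all orders but possibly the [k]-th. *)
Let above k y := [forall (l | l != k), r l (m l) < r l y].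

Let aboveP k y : reflect (forall l, l != k -> r l (m l) < r l y) (above k y).
Proof. exact: forall_inP. Qed.

Let not_above_all y : exists k, r k y <= r k (m k).
Proof. by have /dominantP/(_ y)[k kD] := domD; exists k; exact: kD. Qed.

Let redundant_above k x : k \in redundant -> x \in D -> ~~ above k x.
Proof.
rewrite inE => /eqP <- /imsetP[l]; rewrite !inE andbT => lk ->.
by apply/negP => /aboveP/(_ _ lk); rewrite ltnn.
Qed.

(* Adding [x] to [D] keeps it dominant exactly when [x] becomes the new minimum
   of a redundant order [k] and is greatest in this role: a candidate above [x]
   in the order [k] would exceed all the minima of [x |: D]. *)
Let roomP x : x \notin D ->
  dominant (x |: D) <->
  exists2 k, k \in redundant &
    above k x /\ forall y, above k y -> r k y <= r k x.
Proof.
move=> Dx; split=> [/dominantP dom|[k kR [kx xmax]]].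
  have [k kx] := dom x.
  have other z : z \in D ->
      exists l, l != k /\ forall w, w \in x |: D -> r l z <= r l w.
    move=> Dz; have [l lz] := dom z; exists l; split=> //.
    apply: contraNneq Dx => lk; rewrite -(_ : z = x)//.
    apply/(@r_inj k)/eqP; rewrite eqn_leq kx ?inE ?Dz ?orbT// -lk lz//.
    by rewrite !inE eqxx.
  have minl z l : z \in D -> (forall w, w \in x |: D -> r l z <= r l w) ->
      m l = z.
    by move=> Dz lz; apply: m_eq => // w Dw; rewrite lz// inE Dw orbT.
  have kR : k \in redundant.
    rewrite inE finset.eqEsubset; apply/andP; split.
      by apply/fintype.subsetP => _ /imsetP[l _ ->].
    apply/fintype.subsetP => z Dz; have [l [lk /(minl _ _ Dz)<-]] := other _ Dz.
    by rewrite imset_f// !inE lk.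
  exists k => //; split.
    apply/aboveP => l lk; rewrite ltnNge; apply/negP => xl.
    (* Otherwise [x] is the minimum for both [k] and [l], and too few orders
       remain for the elements of [D]. *)
    suff : #|D| <= #|([set: I] :\ k) :\ l|.
      have := cardsD1 l ([set: I] :\ k); have := cardsD1 k [set: I].
      by rewrite cardsT !inE lk/= -cardD; lia.
    suff DE : m @: ([set: I] :\ k :\ l) = D by rewrite -[in leqLHS]DE leq_imset_card.
    apply/eqP; rewrite finset.eqEsubset; apply/andP; split.
      by apply/fintype.subsetP => _ /imsetP[? _ ->].
    apply/fintype.subsetP => z Dz; have [j [jk jz]] := other _ Dz.
    rewrite -(minl _ _ Dz jz) imset_f// !inE jk !andbT.
    apply: contraNneq Dx => jl; rewrite -(_ : z = x)//.
    apply/(@r_inj l)/eqP; rewrite eqn_leq (leq_trans xl) ?m_min// andbT.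
    by rewrite -jl jz// !inE eqxx.
  move=> y ky; rewrite leqNgt; apply/negP => xy.
  have [l ly] := dom y; have [lk|lk] := eqVneq l k.
    by have := ly x; rewrite !inE eqxx lk leqNgt xy => /(_ isT).
  by move/aboveP: ky => /(_ _ lk); rewrite ltnNge ly// inE mD orbT.
apply/dominantP => y.
have [ky|] := boolP (above k y).
  have [l lD] := not_above_all y; have lk : l = k.
    by apply/eqP; apply: contraTT lD => lk; rewrite -ltnNge (aboveP _ _ ky).
  exists k => w; rewrite !inE => /predU1P[->|Dw]; first exact: xmax.
  by rewrite -lk (leq_trans lD)// m_min.
rewrite negb_forall_in => /exists_inP[l lk]; rewrite -leqNgt => lD.
exists l => w; rewrite !inE => /predU1P[->|Dw].
  by rewrite (leq_trans lD)// ltnW// (aboveP _ _ kx).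
by rewrite (leq_trans lD)// m_min.
Qed.

(* Ensures that a candidate exists for each redundant order. *)
Hypothesis entrant : forall k, exists x, forall l, l != k -> r l v < r l x.

(** The analogue of the fact that an interior facet of a triangulation lies in
    two simplices: one extension for each of the two redundant orders. *)
Lemma card_dominant_rooms :
  #|[set A : {set V} | [&& D \subset A, dominant A & #|A| == #|I|]]| = 2.
Proof.
have best k : k \in redundant ->
    exists x, above k x /\ forall y, above k y -> r k y <= r k x.
  move=> _; have [x vx] := entrant k.
  have kx : above k x.
    by apply/aboveP => l /vx; apply: leq_ltn_trans; exact: m_min.
  by case: (@arg_maxnP _ x (above k) (r k) kx) => z; exists z.
pose e k := odflt v [pick x | above k x & [forall (y | above k y), r k y <= r k x]].
have eP k : k \in redundant -> above k (e k) /\ forall y, above k y -> r k y <= r k (e k).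
  move=> /best[x [kx xmax]]; rewrite /e; case: pickP =>
    [y /andP[ky /forall_inP]//|/(_ x)].
  by rewrite kx => /forall_inP.
have eD k : k \in redundant -> e k \notin D.
  by move=> kR; have [ke _] := eP _ kR; apply: contraL ke; exact: redundant_above.
have e_inj : {in redundant &, injective (fun k => e k |: D)}.
  move=> k l kR lR /= ekl; apply/eqP; apply: contraT => kl.
  have ee : e k = e l.
    have : e k \in e l |: D by rewrite -ekl !inE eqxx.
    by rewrite !inE (negPf (eD _ kR)) orbF => /eqP.
  have [j] := not_above_all (e k); apply: contraTT => _; rewrite -ltnNge.
  have [/aboveP ke _] := eP _ kR; have [/aboveP le _] := eP _ lR.
  by have [jk|/ke//] := eqVneq j k; rewrite ee le// jk.
rewrite -card_redundant_min -(card_in_imset e_inj); apply: eq_card => A; rewrite inE.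
apply/and3P/imsetP => [[DA domA /eqP cA]|[k kR ->]].
  have /eqP/cards1P[x Ax] : #|A :\: D| = 1.
    by rewrite cardsDS// cA -cardD subSn// subnn.
  have AE : A = x |: D.
    apply/setP => z; rewrite -Ax !inE.
    by have [/(fintype.subsetP DA)->|] := boolP (z \in D); rewrite ?orbT ?orbF.
  have Dx : x \notin D by have := set11 x; rewrite -Ax inE => /andP[].
  move: domA; rewrite AE => /(roomP Dx)[k kR [kx xmax]]; exists k => //.
  congr (_ |: _); apply/(@r_inj k)/eqP; rewrite eqn_leq.
  by have [ke emax] := eP _ kR; rewrite emax//= xmax.
split; first exact: finset.subsetUr.
- by apply/(roomP (eD _ kR)); exists k; [|exact: eP].
- by rewrite cardsU1 eD// add1n cardD.
Qed.

End door.

(** * Scarf's lemma *)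

Section scarf.
Variables (s : I -> V) (c : V -> I) (v0 : V) (i0 : I).
Hypotheses (cs : cancel s c) (v0s : v0 \notin codom s).
Hypothesis s_least : forall k v, v != s k -> r k (s k) < r k v.
Hypothesis s_above : forall k j v, j != k -> v \notin codom s -> r k v < r k (s j).

(* The slack points [s k] play the role of the faces of the simplex: [s k] is
   the least point in the order [k] and above all ordinary points in the other
   orders.  The full dominant sets are the rooms; the doors are the sets that
   carry all the labels but [i0], once each. *)
Let room A := dominant A && (#|A| == #|I|).
Let door D := (c @: D == ~: [set i0]) && (#|D|.+1 == #|I|).

(* The only door on the boundary. *)
Let door0 := s @: (~: [set i0]).

Let s_inj : injective s := can_inj cs.

Let door0P D : door D -> D \subset codom s -> D = door0.
Proof.
move=> /andP[/eqP cD _] /fintype.subsetP Ds; rewrite /door0 -cD; apply/setP => x.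
apply/idP/imsetP => [Dx|[_ /imsetP[y Dy ->] ->]].
  by exists (c x); [exact: imset_f|have /codomP[i ->] := Ds _ Dx; rewrite cs].
by have /codomP[i yi] := Ds _ Dy; rewrite yi cs -yi.
Qed.

Let card_door0 : #|door0|.+1 = #|I|.
Proof.
by rewrite card_imset// cardsC1 prednK//; apply/card_gt0P; exists i0.
Qed.

Let door_door0 : door door0.
Proof.
rewrite /door card_door0 eqxx andbT -imset_comp; apply/eqP/setP => i.
apply/imsetP/idP => [[j ji ->]|ii]; first by rewrite /= cs.
by exists i; rewrite //= cs.
Qed.

(* A slack point is above ordinary points in all orders but its own, so only
   the order [i0] is left to witness dominance: the one room of [door0] is
   obtained by adding the greatest ordinary point for [i0]. *)
Let card_rooms_door0 :
  #|[set A : {set V} | [&& door0 \subset A, dominant A & #|A| == #|I|]]| = 1.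
Proof.
pose x := [arg max_(w > v0 | w \notin codom s) r i0 w].
have [xs xmax] : x \notin codom s /\
    forall w, w \notin codom s -> r i0 w <= r i0 x.
  by rewrite /x; case: arg_maxnP.
have s0 j : j != i0 -> s j \in door0 by move=> ji; rewrite imset_f// !inE.
have nonslack w : w \notin codom s -> w \notin door0.
  by apply: contraNN => /imsetP[j _ ->]; exact: codom_f.
rewrite -(cards1 (x |: door0)); apply: eq_card => A; rewrite !inE.
apply/and3P/eqP => [[DA /dominantP domA /eqP cA]|->].
  have /eqP/cards1P[y Ay] : #|A :\: door0| = 1.
    by rewrite cardsDS// cA -card_door0 subSn// subnn.
  have AE : A = y |: door0.
    apply/setP => z; rewrite -Ay !inE.
    by have [/(fintype.subsetP DA)->|] := boolP (z \in door0); rewrite ?orbT ?orbF.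
  have Dy : y \notin door0 by have := set11 y; rewrite -Ay inE => /andP[].
  have yA : y \in A by rewrite AE !inE eqxx.
  have x_y : r i0 x <= r i0 y.
    have [k kx] := domA x; have [->|ki] := eqVneq i0 k; first exact: kx.
    have := kx (s k); rewrite (fintype.subsetP DA) ?s0 1?eq_sym// => /(_ isT).
    by rewrite leqNgt s_least// (contraNneq _ xs)// => ->; exact: codom_f.
  have ys : y \notin codom s.
    apply/negP => /codomP[j yj]; move: x_y; have [ji|ji] := eqVneq j i0.
      by rewrite yj ji leqNgt s_least// (contraNneq _ xs)// => ->; exact: codom_f.
    by move: Dy; rewrite yj s0.
  rewrite AE; congr (_ |: _); apply/(@r_inj i0)/eqP.
  by rewrite eqn_leq x_y xmax.
split; first exact: finset.subsetUr.
- apply/dominantP => y; have [/codomP[j ->]|ys] := boolP (y \in codom s).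
    exists j => w _; have [->//|wj] := eqVneq w (s j).
    exact/ltnW/s_least.
  exists i0 => w; rewrite !inE => /predU1P[->|]; first exact: xmax.
  by move=> /imsetP[j]; rewrite !inE => ji ->; exact/ltnW/s_above.
- by rewrite cardsU1 nonslack// add1n card_door0.
Qed.

Let even_rooms D : door D -> D != door0 ->
  ~~ odd #|[set A : {set V} | [&& D \subset A, dominant A & #|A| == #|I|]]|.
Proof.
move=> dD D0; have /subsetPn[v Dv vs] : ~~ (D \subset codom s).
  by apply: contra D0 => /(door0P dD)->.
have [domD|ndomD] := boolP (dominant D).
  rewrite (@card_dominant_rooms _ v)//; first by have /andP[_ /eqP] := dD.
  by move=> k; exists (s k) => l lk; apply: s_above => //; rewrite eq_sym.
rewrite (_ : [set _ | _] = finset.set0) ?cards0//; apply/setP => A; rewrite !inE.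
by apply/negP => /and3P[/dominantS DA /DA]; rewrite (negPf ndomD).
Qed.

(* As in Sperner's lemma: if the labels on the room [A] are all but [i0], one
   label occurs twice and either occurrence can be removed; if another label is
   missing, [A] has no door. *)
Let even_doors A : #|A| = #|I| -> c @: A != [set: I] ->
  ~~ odd #|[set D : {set V} | (D \subset A) && door D]|.
Proof.
move=> cA cAT; set S := [set _ | _].
have [->|/set0Pn[D]] := eqVneq S finset.set0; first by rewrite cards0.
rewrite inE => /andP[DA /andP[/eqP cD _]].
have cAE : c @: A = ~: [set i0].
  apply/eqP; rewrite eq_sym finset.eqEsubset -{1}cD imsetS//=.
  apply/fintype.subsetP => i ci; rewrite !inE; apply: contraNneq cAT => ii0.
  rewrite finset.eqEsubset finset.subsetT/=; apply/fintype.subsetP => j _.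
  have [->|ji] := eqVneq j i0; first by rewrite -ii0.
  by rewrite (fintype.subsetP (imsetS c DA))// cD !inE.
have cA1 : #|A| = #|c @: A|.+1.
  by rewrite cAE cardsC1 cA prednK//; apply/card_gt0P; exists i0.
have A1_inj : {in [set x in A | c @: (A :\ x) == c @: A] &,
    injective (fun x => A :\ x)}.
  move=> x y; rewrite !inE => /andP[Ax _] _ Axy.
  have := setD11 x A; rewrite Axy !inE Ax andbT.
  by move/negbFE/eqP.
rewrite [X in odd X](_ : _ = 2)// -(card_redundant cA1) -(card_in_imset A1_inj).
apply/esym/eq_card => B; apply/imsetP/idP => [[x]|].
  rewrite !inE => /andP[Ax /eqP cx] ->; rewrite subsetDl /door cx cAE eqxx/=.
  by rewrite -cA (cardsD1 x A) Ax.
rewrite !inE => /and3P[BA /eqP cB /eqP card_B].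
have /eqP/cards1P[x Ax] : #|A :\: B| = 1.
  by rewrite cardsDS// cA -card_B subSn// subnn.
have BE : B = A :\ x.
  apply/setP => z; rewrite -Ax !inE.
  by have [/(fintype.subsetP BA)->|] := boolP (z \in B) => //; case: (z \in A).
exists x => //; rewrite inE -BE cB cAE eqxx andbT.
by have := set11 x; rewrite -Ax inE => /andP[].
Qed.

(** If no room had all the labels, the pairs of a door and a room containing it
    would be even in number when counted by rooms, but odd when counted by doors,
    because of [door0]. *)
Theorem scarf : exists2 A : {set V}, dominant A & c @: A = [set: I].
Proof.
pose F D := #|[set A : {set V} | [&& D \subset A, dominant A & #|A| == #|I|]]|.
pose G A := #|[set D : {set V} | (D \subset A) && door D]|.
have FG : \sum_(D | door D) F D = \sum_(A | room A) G A.
  have FE D : F D = \sum_(A | room A) (D \subset A).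
    rewrite /F -sum1dep_card big_mkcond [RHS]big_mkcond; apply: eq_bigr => A _.
    rewrite /room andbC -andbA.
    case: (D \subset A); case: (dominant A); case: (#|A| == #|I|) => //.
  have GE A : G A = \sum_(D | door D) (D \subset A).
    rewrite /G -sum1dep_card big_mkcond [RHS]big_mkcond; apply: eq_bigr => D _.
    by case: (_ \subset _); case: (door _).
  under eq_bigr do rewrite FE; under [RHS]eq_bigr do rewrite GE.
  exact: exchange_big.
have oddF : odd (\sum_(D | door D) F D).
  apply: (odd_sum door_door0); first by rewrite /F card_rooms_door0.
  exact: even_rooms.
have [/exists_inP[A /andP[domA _] /eqP cA]|noA] :=
  boolP [exists A in room, c @: A == [set: I]]; first by exists A.
exfalso; move: oddF; apply/negP; rewrite FG.
apply: (big_ind (fun n => ~~ odd n)) => [//|m n mE nE|A rA].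
  by rewrite oddD; case: odd mE nE.
apply: even_doors; first by have /andP[_ /eqP] := rA.
by apply: contraNN noA => cA; apply/exists_inP; exists A.
Qed.

End scarf.
End dominant.

(** * Labellings of the grid of a simplex *)

Section grid.
Variables (n N : nat).

Definition grid := {t : {ffun 'I_n.+1 -> 'I_N.+1} | \sum_i (t i : nat) == N}.

Definition gcoord (t : grid) (i : 'I_n.+1) : nat := val t i.

Lemma sum_gcoord t : \sum_i gcoord t i = N.
Proof. exact/eqP/(valP t). Qed.

Lemma grid_of (g : 'I_n.+1 -> nat) : \sum_i g i = N ->
  exists t, forall i, gcoord t i = g i.
Proof.
move=> gN; have gE i : (inord (g i) : 'I_N.+1) = g i :> nat.
  by rewrite inordK// ltnS -gN (bigD1 i)//= leq_addr.
have gP : \sum_i ([ffun i => inord (g i)] i : 'I_N.+1) == N.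
  by rewrite -[X in _ == X]gN; apply/eqP; apply: eq_bigr => i _; rewrite ffunE gE.
pose t : grid := Sub [ffun i => inord (g i) : 'I_N.+1] gP.
by exists t => i; rewrite /gcoord/= ffunE gE.
Qed.

(** Raising all the coordinates but the [j]-th by one, at the expense of the
    [j]-th: this is the point on which dominance is tested below. *)
Lemma grid_shift (t : grid) (j : 'I_n.+1) : n <= gcoord t j ->
  exists y, gcoord y j = gcoord t j - n /\
    forall i, i != j -> gcoord y i = (gcoord t i).+1.
Proof.
move=> nt.
have [|y yE] := @grid_of
    (fun i => if i == j then gcoord t j - n else (gcoord t i).+1).
  rewrite (bigD1 j)//= eqxx.
  rewrite (eq_bigr (fun i => 1 + gcoord t i)); last by move=> i /negPf->.
  rewrite big_split/= sum1_card cardC1 card_ord/= addnA subnK//.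
  by rewrite -[RHS](sum_gcoord t) [RHS](bigD1 j).
exists y; split=> [|i ij]; first by rewrite yE eqxx.
by rewrite yE (negPf ij).
Qed.

(** Scarf's lemma, for the orders given by the coordinates (ties broken
    arbitrarily), gives a dominant set [B] of grid points and slack points.  If a
    coordinate of [s] exceeded that of [t] by more than [n], the shifted point
    would be above [s] in the other coordinates and above [t] in this one.  In
    the same way, a grid point with a coordinate [i] exceeding [n] cannot be in
    [B] along with the [i]-th slack point, so the label [i] is then used by a
    grid point. *)
Lemma grid_label (c : grid -> 'I_n.+1) : exists2 A : {set grid}, A != finset.set0 &
  (forall s t, s \in A -> t \in A -> forall j, gcoord s j <= gcoord t j + n) /\
  (forall i, (forall t, t \in A -> gcoord t i <= n) \/ exists2 t, t \in A & c t = i).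
Proof.
pose V : finType := (grid + 'I_n.+1)%type.
(* The coordinates of grid points are shifted by one to leave room for the slack
   points below them; [N.+2] exceeds them all. *)
pose co (v : V) k := match v with
  | inl t => (gcoord t k).+1
  | inr j => if j == k then 0 else N.+2 end.
pose r k (v : V) := co v k * #|V| + enum_rank v.
have r_lt k v w : co v k < co w k -> r k v < r k w.
  move=> vw; apply: (@leq_trans (co w k * #|V|)); last exact: leq_addr.
  apply: (@leq_trans ((co v k).+1 * #|V|)); last by rewrite leq_mul2r vw orbT.
  by rewrite /r mulSn [leqRHS]addnC ltn_add2l.
have r_inj k : injective (r k).
  move=> v w vw; have vwk : co v k = co w k.
    have [/(r_lt k)|/(r_lt k)|//] := ltngtP (co v k) (co w k).
      by rewrite vw ltnn.
    by rewrite vw ltnn.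
  by move: vw; rewrite /r vwk => /addnI/ord_inj/enum_rank_inj.
pose cV (v : V) := match v with inl t => c t | inr j => j end.
have [t0 _] : exists t : grid, forall i, gcoord t i = if i == ord0 then N else 0.
  by apply: grid_of; rewrite -big_mkcond big_pred1_eq.
have [||k v|k j v|B domB cB] := @scarf V _ r r_inj inr cV (inl t0) ord0.
- by [].
- by apply/codomP => -[].
- move=> vk; apply: r_lt; rewrite /= eqxx; case: v vk => //= i ik.
  by rewrite ifN//; apply: contraNneq ik => ->.
- move=> jk; case: v => [t _|i]; last by rewrite codom_f.
  by apply: r_lt; rewrite /= (negPf jk) ltnS ltnS /gcoord -ltnS.
pose A := [set t : grid | inl t \in B].
have domA (y : grid) : exists k, forall v : V, v \in B -> (gcoord y k).+1 <= co v k.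
  have /dominantP/(_ (inl y))[k yk] := domB; exists k => v Bv.
  rewrite leqNgt; apply/negP => vy; have := yk v Bv.
  by rewrite leqNgt (@r_lt k v (inl y)).
have AB t : t \in A -> inl t \in B by rewrite inE.
have labels i : inr i \in B \/ exists2 t, t \in A & c t = i.
  have : i \in cV @: B by rewrite cB inE.
  move=> /imsetP[[t|j] Bv ->]; [right|by left].
  by exists t; rewrite ?inE.
exists A; [|split].
- have [k kB] := domA t0; have [/kB|[t At _]] := labels k; first by rewrite /= eqxx.
  by apply/set0Pn; exists t.
- move=> s t As At j; rewrite leqNgt; apply/negP => ts.
  have [|y [yj yi]] := @grid_shift s j; first by lia.
  have [k yk] := domA y; have [kj|kj] := eqVneq k j.
    by have := yk _ (AB _ At); rewrite /= kj yj; lia.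
  by have := yk _ (AB _ As); rewrite /= yi//; lia.
- move=> i; have [iB|] := labels i; [left => t At|by right].
  rewrite leqNgt; apply/negP => nt.
  have [|y [yj yi]] := @grid_shift t i; first by lia.
  have [k yk] := domA y; have [ki|ki] := eqVneq k i.
    by have := yk _ iB; rewrite /= ki eqxx.
  by have := yk _ (AB _ At); rewrite /= yi//; lia.
Qed.

End grid.

Local Open Scope classical_set_scope.
Local Open Scope ring_scope.

(** * Closed covers of the standard simplex *)

Lemma continuous_sum (T : topologicalType) (V : TopologicalNmodule.type)
    (I : Type) (s : seq I) (f : I -> T -> V) :
  (forall i, continuous (f i)) -> continuous (fun x => \sum_(i <- s) f i x).
Proof.
move=> fc; elim: s => [|i s IHs] x.
  under eq_fun do rewrite big_nil; exact: cvg_cst.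
under eq_fun do rewrite big_cons.
have -> : (fun y => f i y + \sum_(j <- s) f j y) =
  (fun p : V * V => p.1 + p.2) \o (fun y => (f i y, \sum_(j <- s) f j y)) by [].
apply: (@continuous_comp T (V * V)%type V
  (fun y => (f i y, \sum_(j <- s) f j y)) (fun p => p.1 + p.2));
  last exact: add_continuous.
by apply: cvg_pair => /=; [exact: fc|exact: IHs].
Qed.

Section simplex.
Context {R : realType} {n : nat}.
Implicit Types t : 'rV[R]_n.+1.

Definition simplex : set 'rV[R]_n.+1 :=
  [set t | (forall i, 0 <= t 0 i) /\ \sum_i t 0 i = 1].

Lemma simplex_compact : compact simplex.
Proof.
apply: (@subclosed_compact _ simplex [set t | forall i, `[0, 1]%classic (t 0 i)]).
- have -> : simplex = (\bigcap_i [set t : 'rV[R]_n.+1 | 0 <= t 0 i]) `&`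
      [set t : 'rV[R]_n.+1 | \sum_i t 0 i = 1].
    apply/seteqP; split=> t /= [t0 t1]; split=> // i; last exact: t0.
    by move=> _; exact: t0.
  apply: closedI.
    apply: closed_bigI => i _.
    by apply: (@preimage_closed _ _ (fun t : 'rV[R]_n.+1 => t 0 i) [set x | 0 <= x]);
      [move=> t _; exact: coord_continuous|exact: closed_ge].
  apply: (@preimage_closed _ _ (fun t : 'rV[R]_n.+1 => \sum_i t 0 i) [set x | x = 1]);
    last exact: closed_eq.
  move=> t _; apply: (@continuous_sum _ (R^o : TopologicalNmodule.type)) => i.
  exact: coord_continuous.
- by apply: (@rV_compact R n.+1 (fun=> `[0, 1]%classic)) => _; exact: segment_compact.
- move=> t [t0 t1] i; rewrite /= in_itv/= t0/= -t1 (bigD1 i)//= lerDl.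
  by rewrite sumr_ge0.
Qed.

(** Suppose that each [t] of the simplex avoids some [A i] with [t 0 i > 0].  This
    persists on a neighbourhood of [t], whose size can be taken uniform by
    compactness, hence larger than the sets that [grid_label] gives on a fine
    enough grid.  Label each grid point by some [i] such that [A i] contains it:
    then such a set meets [A i] or has a small [i]-th coordinate, for each [i],
    which excludes the [i] avoided near one of its points. *)
Lemma simplex_cover_closed (A : 'I_n.+1 -> set 'rV[R]_n.+1) :
  (forall i, closed (A i)) -> simplex `<=` \bigcup_i A i ->
  exists2 t, simplex t & forall i, 0 < t 0 i -> A i t.
Proof.
move=> Acl Acov; apply: contrapT => noA.
have bad t : simplex t -> exists2 i, 0 < t 0 i & ~ A i t.
  move=> tS; apply: contrapT => nobad; apply: noA; exists t => // i ti.
  by apply: contrapT => Ait; apply: nobad; exists i.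
(* The radius [n / N.+1] is the diameter of the sets given by [grid_label] for
   the grid of denominator [N.+1]. *)
pose P N t := exists i, forall s : 'rV[R]_n.+1,
  (forall l, `|t 0 l - s 0 l| <= n%:R / N.+1%:R) ->
  n%:R / N.+1%:R < s 0 i /\ ~ A i s.
have : \forall N \near \oo, simplex `<=` P N.
  apply: ((@compact_near_coveringP _ simplex).1 _ _ _ P)
    => [|t0 t0S]; first exact: simplex_compact.
  have [i t0i At0] := bad _ t0S.
  have /nbhs_ballP[e /= e0 eA] : nbhs t0 (~` A i).
    by apply: open_nbhs_nbhs; split=> //; exact: closed_openC.
  pose h := Num.min e (t0 0 i / 2).
  have h0 : 0 < h by rewrite lt_min e0 divr_gt0.
  exists (ball t0 (h / 2), [set N : nat | n%:R / N.+1%:R < h / 2]).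
    split; first by apply: nbhsx_ballx; rewrite divr_gt0.
    have hn : 0 < h / 2 / n.+1%:R by rewrite !divr_gt0.
    apply: filterS (near_infty_natSinv_lt (PosNum hn)) => N /=.
    rewrite ltr_pdivlMr// => hN; apply: le_lt_trans hN.
    by rewrite mulrC ler_wpM2l// ler_nat.
  move=> [t N] [/= tt0 hN].
  have {}tt0 l : ball (t0 0 l) (h / 2) (t 0 l) by case: tt0 => _; apply.
  exists i => s ts.
  have t0s l : `|t0 0 l - s 0 l| < h.
    have := ts l; have := tt0 l; rewrite /ball/= => t0t ts'.
    rewrite (le_lt_trans (ler_distD (t 0 l) _ _))//.
    by rewrite (splitr h) ltrD// (le_lt_trans ts').
  split.
    have := t0s i; have hti : h <= t0 0 i / 2 by rewrite ge_min lexx orbT.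
    rewrite ltr_distlC => /andP[ths _]; apply: (lt_trans hN).
    by move: h0 hti ths; clearbody h; lra.
  apply: eA; split=> // l j; rewrite (ord1 l) /ball/= (lt_le_trans (t0s j))//.
  by rewrite ge_min lexx.
move=> [N _ /(_ N (leqnn N)) PN].
pose pt (g : grid n N.+1) : 'rV[R]_n.+1 := \row_i ((gcoord g i)%:R / N.+1%:R).
have ptS g : simplex (pt g).
  split=> [i|]; first by rewrite mxE divr_ge0.
  under eq_bigr do rewrite mxE.
  by rewrite -mulr_suml -natr_sum sum_gcoord divff// pnatr_eq0.
have /choice[c cA] g : exists i, A i (pt g).
  by have [i _ Ai] := Acov _ (ptS g); exists i.
have [B /set0Pn[g Bg] [Bdiam Blab]] := grid_label c.
have [i ti] := PN _ (ptS g).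
have near_t s : s \in B -> forall l, `|pt g 0 l - pt s 0 l| <= n%:R / N.+1%:R.
  move=> Bs l; rewrite !mxE -mulrBl normrM [X in _ * X]ger0_norm//.
  rewrite ler_wpM2r// ler_distlC lerBlDr -!natrD !ler_nat.
  by rewrite !Bdiam.
case: (Blab i) => [small|[s Bs si]].
  have [+ _] := ti _ (near_t _ Bg).
  by rewrite mxE ltNge ler_wpM2r// ler_nat small.
by have [_] := ti _ (near_t _ Bs); rewrite -si; apply; exact: cA.
Qed.

End simplex.

Lemma convex_set_sum (R : realType) (M : lmodType R) (C : set M) (n : nat)
    (x : 'I_n -> M) (a : 'I_n -> R) :
  convex_set C -> (forall i, C (x i)) -> (forall i, 0 <= a i) ->
  \sum_i a i = 1 -> C (\sum_i a i *: x i).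
Proof.
move=> Ccvx.
(* Weights of any positive sum, so that the induction may drop the last one. *)
suff gen m (y : 'I_m -> M) (b : 'I_m -> R) : (forall i, C (y i)) ->
    (forall i, 0 <= b i) -> 0 < \sum_i b i ->
    C ((\sum_i b i)^-1 *: \sum_i b i *: y i).
  move=> Cx a0 a1; have := gen _ x a Cx a0; rewrite a1 invr1 scale1r.
  by apply.
elim: m y b => [|m IHm] y b Cy b0; first by rewrite big_ord0 ltxx.
rewrite !big_ord_recr/=; set b' := \sum_(i < m) _; set v := \sum_(i < m) _.
set bm := b ord_max; set ym := y ord_max => bpos.
have b'0 : 0 <= b' by rewrite sumr_ge0.
have [b'E|b'N] := eqVneq b' 0.
  have -> : v = 0.
    apply: big1 => i _; have /eqP := b'E; rewrite psumr_eq0// => /allP/(_ i).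
    by rewrite mem_index_enum => /(_ isT)/eqP ->; rewrite scale0r.
  move: bpos; rewrite b'E !add0r => /lt0r_neq0 bm0.
  by rewrite scalerA mulVf// scale1r; exact: Cy.
have b'p : 0 < b' by rewrite lt0r b'N.
have Cv : C (b'^-1 *: v) by apply: IHm => // i; exact: Cy.
have l0 : 0 <= b' / (b' + bm) by rewrite divr_ge0// ltW.
have l1 : b' / (b' + bm) <= 1 by rewrite ler_pdivrMr// mul1r lerDl b0.
have := Ccvx (b'^-1 *: v) ym (Itv01 l0 l1).
rewrite !inE => /(_ Cv (Cy _)).
congr (C _); rewrite /conv/= /unstable.onem scalerDr !scalerA; congr (_ *: _ + _ *: _).
  by field; rewrite b'N lt0r_neq0.
by field; rewrite lt0r_neq0.
Qed.

(** * Approximate fixed points *)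

Section metric.
Context {R : realType} {X : topologicalType} {d : X -> X -> R}.
Hypothesis d_metric : metric_inducing d.

Lemma dist_ge0 x y : 0 <= d x y.
Proof.
have := dist_triangle d_metric y x x.
by rewrite (distxx d_metric) (dist_sym d_metric y x) -mulr2n pmulrn_lge0.
Qed.

Lemma open_dist_lt x e : open [set y | d x y < e].
Proof.
rewrite openE => y /= xy; rewrite /interior (nbhs_dist d_metric).
exists (e - d x y); first by rewrite /= subr_gt0.
move=> z /= yz; apply: (le_lt_trans (dist_triangle d_metric y x z)).
by rewrite -ltrBrDl.
Qed.

Lemma closed_dist_le x e : closed [set y | d x y <= e].
Proof.
rewrite -openC openE => y /= /negP; rewrite -ltNge => xy.
rewrite /interior (nbhs_dist d_metric).
exists (d x y - e); first by rewrite /= subr_gt0.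
move=> z /= yz; apply/negP; rewrite -ltNge.
have := dist_triangle d_metric z x y; rewrite (dist_sym d_metric z y); lra.
Qed.

End metric.

Section approximate_fixed_point.
Variables (R : realType) (X : topologicalLmodType R) (d : X -> X -> R).
Variables (C : set X) (f : X -> X).
Hypotheses (d_metric : metric_inducing d) (C_nonempty : C !=set0).
Hypotheses (C_compact : compact C) (C_convex : convex_set C).
Hypotheses (f_onto : set_surj C C f).
Hypothesis f_comb : forall (n : nat) (x : 'I_n -> X) (a : 'I_n -> R),
  injective x -> (forall i, C (x i)) -> (forall i, 0 < a i) ->
  \sum_(i < n) a i = 1 ->
  let u := \sum_(i < n) a i *: x i in
  d (f u) u <= \big[Num.max/0]_(j < n) d (f (x j)) u.

(** The reduction to [simplex_cover_closed], through the map [u] from the simplex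
    to the convex hull of the centres [x i]. *)
Lemma approximate_fixed_point b : 0 < b -> exists2 u, C u & d (f u) u <= b.
Proof.
move=> b0.
have : finite_subset_cover C (fun x => [set z | d (f x) z < b]) C.
  (* [compact_cover] asks for a base point, here [0]. *)
  pose pX : ptopologicalType := HB.pack (X : Type) (isPointed.Build X 0) X.
  have : compact (C : set pX) by exact: C_compact.
  rewrite compact_cover; apply.
    by move=> x _; exact: open_dist_lt.
  by move=> y /f_onto[x Cx <-]; exists x; rewrite //= (distxx d_metric).
move=> [F FC CF].
have [c0 Cc0] := C_nonempty.
pose s : seq X := finmap.enum_fset F.
have sE : size s = (size s).-1.+1.
  have [x /= xF _] := CF _ Cc0; have : x \in s by [].
  by case: (s).
set n := (size s).-1 in sE.
pose x (i : 'I_n.+1) := nth c0 s i.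
have s_lt (i : 'I_n.+1) : (i < size s)%N by rewrite sE.
have Cx i : C (x i) by apply/set_mem/FC; exact: mem_nth.
have x_inj : injective x.
  by move=> i j /eqP; rewrite /x nth_uniq// ?finmap.fset_uniq// => /eqP/ord_inj.
pose u (t : 'rV[R]_n.+1) := \sum_i t 0 i *: x i.
have u_cont : continuous u.
  apply: continuous_sum => i t.
  apply: (@continuous_comp _ (R^o * X)%type X (fun t : 'rV[R]_n.+1 => (t 0 i, x i))
    (fun z => z.1 *: z.2)); last exact: scale_continuous.
  have ti : (fun t : 'rV[R]_n.+1 => t 0 i) @ t --> (t 0 i : R^o).
    exact: coord_continuous.
  exact: (cvg_pair ti (cvg_cst _)).
have Cu t : simplex t -> C (u t) by move=> [t0 t1]; exact: convex_set_sum.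
pose A (i : 'I_n.+1) := [set t | d (f (x i)) (u t) <= b].
have [||t tS tA] := @simplex_cover_closed _ _ A.
- move=> i; apply: (@preimage_closed _ _ u [set y | d (f (x i)) y <= b]).
    by move=> t _; exact: u_cont.
  exact: closed_dist_le.
- move=> t /Cu/CF[y /= ys yt].
  have ys' : y \in s by [].
  have ylt : (index y s < n.+1)%N by rewrite -sE index_mem.
  by exists (Ordinal ylt) => //; rewrite /A/= /x/= nth_index// ltW.
have [t0 t1] := tS.
exists (u t); first exact: Cu.
pose S := [pred i | 0 < t 0 i].
have tN0 i : i \notin S -> t 0 i = 0.
  by rewrite inE lt0r t0 andbT negbK => /eqP.
have := @f_comb _ (x \o @enum_val _ S) ((t 0) \o @enum_val _ S).
rewrite /= -(big_enum_val (t 0)) -(big_enum_val (fun i => t 0 i *: x i)) /=.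
have -> : \sum_(i in S) t 0 i *: x i = u t.
  rewrite big_mkcond; apply: eq_bigr => i _; case: ifPn => // /tN0 ->.
  by rewrite scale0r.
have -> : \sum_(i in S) t 0 i = 1.
  by rewrite -t1 big_mkcond; apply: eq_bigr => i _; case: ifPn => // /tN0 ->.
move=> /(_ (inj_comp x_inj enum_val_inj)) ut.
apply: le_trans (ut _ _ erefl) _ => [i|i|]; first exact: Cx.
- exact: (enum_valP i).
- apply: bigmax_le; first exact: ltW.
  by move=> j _; apply: tA; exact: (enum_valP j).
Qed.

End approximate_fixed_point.

(** * The fixed point theorem *)

Theorem theorem5 (R : realType) (X : topologicalLmodType R) (d : X -> X -> R)
    (d_metric : metric_inducing d) (C : set X) (f : {fun C >-> C})
    (C_nonempty : C !=set0)
    (C_compact : compact C)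
    (C_convex : convex_set C)
    (f_onto : set_surj C C f)
    (f_comb : forall (n : nat) (x : 'I_n -> X) (a : 'I_n -> R),
      injective x ->
      (forall i, C (x i)) ->
      (forall i, 0 < a i) ->
      \sum_(i < n) a i = 1 ->
      let u := \sum_(i < n) a i *: x i in
      d (f u) u <= \big[Num.max/0]_(j < n) d (f (x j)) u)
    (f_closed : forall beta : R, 0 < beta ->
      closed [set x | C x /\ d (f x) x <= beta]) :
  fixed_points C f !=set0 /\ closed (fixed_points C f) /\
  fixed_points C f `<=` C.
Proof.
pose F b := [set x | C x /\ d (f x) x <= b].
have fixedE : fixed_points C f = \bigcap_(b in [set b : R | 0 < b]) F b.
  apply/seteqP; split=> [x [Cx fx] b /= /ltW b0|x Fx].
    by split=> //; rewrite fx (distxx d_metric).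
  have [Cx _] := Fx 1 ltr01; split=> //; apply: (dist_eq0 d_metric).
  apply/eqP; rewrite eq_le (dist_ge0 d_metric) andbT.
  by apply/ler_addgt0Pl => b b0; rewrite addr0; have [] := Fx b b0.
split; last split; last by move=> x [].
- (* Without fixed points, each [x] has a neighbourhood free of [b]-fixed points
     for small [b]; compactness makes such a [b] uniform. *)
  apply: contrapT => nofix.
  have : \forall b \near 0^'+, C `<=` [set x | ~ F b x].
    apply: ((@compact_near_coveringP _ C).1 C_compact _ _ (fun b x => ~ F b x)).
    move=> x Cx.
    have fx : 0 < d (f x) x.
      rewrite lt0r (dist_ge0 d_metric) andbT; apply/eqP => fx.
      by apply: nofix; exists x; split=> //; exact: (dist_eq0 d_metric).
    have h0 : 0 < d (f x) x / 2 by rewrite divr_gt0.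
    exists (~` F (d (f x) x / 2), [set b | b < d (f x) x / 2]).
      split; last exact: nbhs_right_lt.
      apply: open_nbhs_nbhs; split; first exact/closed_openC/f_closed.
      by move=> [_]; apply/negP; rewrite -ltNge; move: fx; lra.
    move=> [y b] [/= Fy bh] [Cy fy]; apply: Fy; split=> //.
    by rewrite (le_trans fy)// ltW.
  move/(filterI (nbhs_right_gt 0))/filter_ex => [b [/= b0 Cb]].
  have [u Cu fu] := approximate_fixed_point d_metric C_nonempty C_compact
    C_convex f_onto f_comb b0.
  exact: (Cb u Cu).
- rewrite fixedE; apply: closed_bigI => b; exact: f_closed.
Qed.
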